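(* Let $(J,\Sigma,\mu)$ be a standard measure space, let $\mathcal C\subseteq\Sigma$ be a closed chain containing $\emptyset$, and let $b\colon\mathcal C\to\mathbb R_{\ge0}$ satisfy $b(\emptyset)=0$. Define $$\mathcal F=\{F\in\Sigma\mid\mu(F\cap C)\le b(C)\text{ for every }C\in\mathcal C\}.$$ Then $M=(J,\Sigma,\mu,\mathcal F)$ is a measurable matroid. Moreover, for every $X\in\Sigma$, its rank is given by $$r(X)=\inf_{C\in\mathcal C}\{b(C)+\mu(X\setminus C)\}.$$
   Context: A standard measure space $(J,\Sigma,\mu)$ is a standard Borel space $(J,\Sigma)$ with a finite atomless measure $\mu\colon\Sigma\to[0,\infty)$. Convention: measurable sets are identified when they differ by a $\mu$-null set: $A=B$ means $\mu(A\triangle B)=0$, $A\subseteq B$ means $\mu(A\setminus B)=0$, and families of measurable sets (and functions on them) are understood in the measure algebra. A set $X$ in a family $\mathcal X$ is maximal in $\mathcal X$ if $X\subseteq Y\in\mathcal X$ implies $Y\subseteq X$. Write $\mathcal X|Z=\{X\in\mathcal X\mid X\subseteq Z\}$. A chain is a family $\mathcal C\subseteq\Sigma$ such that for all $C,D\in\mathcal C$, $C\subseteq D$ or $D\subseteq C$. A chain is closed if it is closed under unions of increasing sequences and under intersections of decreasing sequences (indexed by $\mathbb N$) of its members. A measurable matroid $M=(J,\Sigma,\mu,\mathcal F)$ consists of a standard measure space and a family $\mathcal F\subseteq\Sigma$ (the independent sets) satisfying: (I1) $\emptyset\in\mathcal F$; (I2) $F_1\subseteq F_2\in\mathcal F$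 implies $F_1\in\mathcal F$; (I3) for all $X\in\Sigma$ and all maximal $F_1,F_2\in\mathcal F|X$, $\mu(F_1)=\mu(F_2)$; (I4) if $(F_i)_{i\in\mathbb N}$ is an increasing sequence in $\mathcal F$, then $\bigcup_i F_i\in\mathcal F$. Its rank function is $r(X)=\mu(F)$ for any maximal $F\in\mathcal F|X$ (such $F$ exists and the value does not depend on the choice). *)

(* Defs.v *)
From HB Require Import structures.
From mathcomp Require Import all_boot all_order all_algebra.
From mathcomp Require Import all_classical all_reals all_analysis.

Set Implicit Arguments.
Unset Strict Implicit.
Unset Printing Implicit Defensive.

Import Order.TTheory GRing.Theory Num.Theory.

Local Open Scope classical_set_scope.
Local Open Scope ring_scope.
Local Open Scope ereal_scope.

(** Completeness is stated for filters on a [metricType], rather than through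
    the library's complete structures, which combine with pseudometrics only. *)
Definition polish_metric (R : realType) (T : metricType R) : Prop :=
  (forall F : set_system T, ProperFilter F -> cauchy F ->
     exists x : T, F --> x) /\
  (exists S : set T, countable S /\ dense S).

Definition standard_borel (R : realType) (d : measure_display)
    (J : measurableType d) : Prop :=
  exists (T : metricType R) (f : J -> T),
    [/\ polish_metric T, bijective f &
        forall A : set J,
          measurable A <-> exists2 B : set T, <<s open >> B & A = f @^-1` B].

Section measurable_matroids.
Context {R : realType} {d : measure_display} {J : measurableType d}.
Variable mu : {finite_measure set J -> \bar R}.

Definition atomless : Prop :=
  forall A : set J, measurable A -> 0 < mu A ->
    exists B : set J, [/\ measurable B, B `<=` A, 0 < mu B & mu B < mu A].

Definition standard_measure_space : Prop := standard_borel R J /\ atomless.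

(** Inclusion and equality in the measure algebra; they are only used between
    measurable sets. *)
Definition subset_mod0 (A B : set J) : Prop := mu (A `\` B) = 0.

Definition eq_mod0 (A B : set J) : Prop :=
  mu ((A `\` B) `|` (B `\` A)) = 0.

(** A family of elements of the measure algebra is represented by the set of
    all measurable representatives of its members. *)
Definition measurable_family (X : set (set J)) : Prop :=
  X `<=` measurable /\
  (forall A B : set J, X A -> measurable B -> eq_mod0 A B -> X B).

Definition restrict_family (X : set (set J)) (Z : set J) : set (set J) :=
  [set A | X A /\ subset_mod0 A Z].

Definition maximal_in (X : set (set J)) (A : set J) : Prop :=
  X A /\ (forall B : set J, X B -> subset_mod0 A B -> subset_mod0 B A).

Definition chain (C : set (set J)) : Prop :=
  measurable_family C /\
  (forall A B : set J, C A -> C B -> subset_mod0 A B \/ subset_mod0 B A).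

Definition closed_chain (C : set (set J)) : Prop :=
  [/\ chain C,
      forall A : (set J)^nat, (forall n, C (A n)) ->
        (forall n, subset_mod0 (A n) (A n.+1)) -> C (\bigcup_n A n) &
      forall A : (set J)^nat, (forall n, C (A n)) ->
        (forall n, subset_mod0 (A n.+1) (A n)) -> C (\bigcap_n A n)].

Record measurable_matroid (F : set (set J)) : Prop := MeasurableMatroid {
  matroid_space : standard_measure_space ;
  matroid_family : measurable_family F ;
  matroid_I1 : F set0 ;
  matroid_I2 : forall F1 F2 : set J, measurable F1 ->
    subset_mod0 F1 F2 -> F F2 -> F F1 ;
  matroid_I3 : forall X : set J, measurable X -> forall F1 F2 : set J,
    maximal_in (restrict_family F X) F1 ->
    maximal_in (restrict_family F X) F2 -> mu F1 = mu F2 ;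
  matroid_I4 : forall A : (set J)^nat, (forall n, F (A n)) ->
    (forall n, subset_mod0 (A n) (A n.+1)) -> F (\bigcup_n A n)
}.

(** [r] is the rank function of [F]; this includes its well-definedness, i.e.
    existence of a maximal member and independence of its choice. *)
Definition is_rank_function (F : set (set J)) (r : set J -> \bar R) : Prop :=
  forall X : set J, measurable X ->
    (exists A : set J, maximal_in (restrict_family F X) A) /\
    (forall A : set J, maximal_in (restrict_family F X) A -> r X = mu A).

(** [b] is defined on classes of sets, hence the invariance condition; its
    values outside [C] are irrelevant. *)
Definition nonneg_function_on (C : set (set J)) (b : set J -> R) : Prop :=
  (forall A : set J, C A -> (0 <= b A)%R) /\
  (forall A B : set J, C A -> C B -> eq_mod0 A B -> b A = b B).

Definition chain_bounded_family (C : set (set J)) (b : set J -> R) :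
    set (set J) :=
  [set F | measurable F /\ forall A : set J, C A -> mu (F `&` A) <= (b A)%:E].

End measurable_matroids.

(* Main.v *)
Require Import Defs.
From mathcomp Require Import all_boot all_order all_algebra.
From mathcomp Require Import all_classical all_reals all_analysis.
From mathcomp Require Import lra.

Set Implicit Arguments.
Unset Strict Implicit.
Unset Printing Implicit Defensive.

Import Order.TTheory GRing.Theory Num.Theory.

Local Open Scope classical_set_scope.
Local Open Scope ring_scope.
Local Open Scope ereal_scope.

(** Axiom (I1) is nonnegativity of [b]; (I2) and (I4) are monotonicity and
    continuity from below of [mu].  The content is that a maximal independent
    [F] inside [X] has measure [inf_A (b A + mu (X \ A))], which gives (I3)
    and the rank formula at once.

    The inequality [<=] holds for every independent [F] inside [X] and every
    [A] in the chain: split [F] into [F /\ A], of measure at most [b A], and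
    [F \ A], contained in [X \ A] ([bounded_measure_le]).

    For [>=] ([maximal_measure_ge]), fix [e > 0] and call [A] in the chain
    nearly tight if [b A <= mu (F /\ A) + e]; the empty set is nearly tight.
    Let [U] be the essential supremum of the nearly tight sets.  If [X \ F]
    were not almost contained in [U], then by atomlessness [X \ F \ U] would
    contain a set [B] with [0 < mu B <= e].  Adding [B] to [F] violates no
    bound: a nearly tight [A] is disjoint from [B] up to a null set, and any
    other [A] has slack larger than [e].  This contradicts maximality, so
    [X \ F] lies in [U].  As the nearly tight sets form a chain, [U] is an
    increasing countable union of them, and one nearly tight [A] covers
    [X \ F] up to measure [e].  Such an [A] satisfies
    [b A + mu (X \ A) <= mu F + 2e].  The set [U] itself would not do: [b] may
    jump there, and the infimum need not be attained.

    The essential supremum of a directed family ([directed_mod0_sup]) is also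
    what makes Zorn's lemma yield maximal independent subsets
    ([exists_maximal_in]). *)

(** * Inclusion modulo null sets *)

Section measure_algebra.
Context {R : realType} {d : measure_display} {J : measurableType d}.
Variable mu : {finite_measure set J -> \bar R}.
Implicit Types (A B E : set J) (G : set (set J)).

Lemma finite_mu A : measurable A -> mu A \is a fin_num.
Proof. exact: fin_num_measure. Qed.

Lemma mu_splitD A B : measurable A -> measurable B ->
  mu A = mu (A `\` B) + mu (A `&` B).
Proof. exact: measureDI. Qed.

Lemma mu_le A B : measurable A -> measurable B -> A `<=` B -> mu A <= mu B.
Proof. by move=> mA mB AB; apply: le_measure => //; rewrite inE. Qed.

Lemma mu0_sub A B : measurable A -> measurable B -> A `<=` B ->
  mu B = 0 -> mu A = 0.
Proof.
by move=> mA mB /(mu_le mA mB) AB B0; apply/eqP; rewrite -measure_le0 -B0.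
Qed.

Lemma subset_subset_mod0 A B : A `<=` B -> subset_mod0 mu A B.
Proof. by rewrite /subset_mod0 -setD_eq0 => ->; rewrite measure0. Qed.

Lemma subset_mod0_trans B A E : measurable A -> measurable B -> measurable E ->
  subset_mod0 mu A B -> subset_mod0 mu B E -> subset_mod0 mu A E.
Proof.
rewrite /subset_mod0 => mA mB mE AB BE.
apply: (@mu0_sub _ ((A `\` B) `|` (B `\` E))).
- exact: measurableD.
- by apply: measurableU; exact: measurableD.
- move=> x [Ax nEx]; case: (pselect (B x)) => Bx; [by right|by left].
- by rewrite measureU0 //; exact: measurableD.
Qed.

Lemma subset_mod0_measure A B : measurable A -> measurable B ->
  subset_mod0 mu A B -> mu A <= mu B.
Proof.
move=> mA mB AB; rewrite (mu_splitD mA mB) AB add0e.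
by apply: mu_le => //; exact: measurableI.
Qed.

Lemma subset_mod0_setI A B E : measurable A -> measurable B -> measurable E ->
  subset_mod0 mu A B -> subset_mod0 mu (E `&` A) (E `&` B).
Proof.
move=> mA mB mE; apply: mu0_sub.
- by apply: measurableD; exact: measurableI.
- exact: measurableD.
- by move=> x [[Ex Ax] nEB]; split => // /(conj Ex).
Qed.

Lemma measurable_bigcup_seq (A : (set J)^nat) :
  (forall n, measurable (A n)) -> measurable (\bigcup_n A n).
Proof. by move=> mA; exact: bigcup_measurable. Qed.

Lemma measure_bigcup_null (N : (set J)^nat) :
  (forall n, measurable (N n)) -> (forall n, mu (N n) = 0) ->
  mu (\bigcup_n N n) = 0.
Proof.
move=> mN N0; apply/negligibleP; first exact: measurable_bigcup_seq.
apply: (@negligible_bigcup _ _ _ mu) => n.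
by apply/negligibleP; [exact: mN|exact: N0].
Qed.

(** * Sequences increasing modulo null sets *)

(** A sequence increasing modulo null sets increases pointwise once the null
    set where some inclusion fails is added to every term; continuity from
    below then applies. *)
Lemma bigcup_mod0_approx (A : (set J)^nat) E (e : R) :
  (forall n, measurable (A n)) ->
  (forall n, subset_mod0 mu (A n) (A n.+1)) ->
  measurable E -> (0 < e)%R ->
  exists n, mu (E `&` \bigcup_n A n) <= mu (E `&` A n) + e%:E.
Proof.
move=> mA iA mE e0.
set N := \bigcup_n (A n `\` A n.+1).
have mAD n : measurable (A n `\` A n.+1) by exact: measurableD.
have mN : measurable N by exact: measurable_bigcup_seq.
have N0 : mu N = 0 by exact: measure_bigcup_null.
pose W n := E `&` (A n `|` N).
have mW n : measurable (W n) by apply: measurableI => //; exact: measurableU.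
have muW n : mu (W n) = mu (E `&` A n).
  rewrite /W setIUr measureU0 //; try exact: measurableI.
  by apply: (@mu0_sub _ N) => //; exact: measurableI.
have Wi : {homo W : n m / (n <= m)%N >-> (n <= m)%O}.
  apply: homo_leq => [//|? ? ?|n]; first exact: le_trans.
  apply/subsetPset => x [Ex [Ax|Nx]]; split=> //; last by right.
  have [Ax'|Ax'] := pselect (A n.+1 x); first by left.
  by right; exists n.
have UW : \bigcup_n W n = E `&` \bigcup_n A n.
  apply/seteqP; split=> [x [n _ [Ex [Ax|[m _ [Ax _]]]]]|x [Ex [n _ Ax]]].
  - by split=> //; exists n.
  - by split=> //; exists m.
  - by exists n => //; split=> //; left.
have mU := measurable_bigcup_seq mW.
have cW : mu (W n) @[n --> \oo] --> mu (\bigcup_n W n).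
  exact: nondecreasing_cvg_mu.
apply: contrapT => /forallNP nle.
have : mu (\bigcup_n W n) <= mu (\bigcup_n W n) - e%:E.
  rewrite -{1}(cvg_lim _ cW) //; apply: lime_le.
    by apply/cvg_ex; exists (mu (\bigcup_n W n)).
  near=> n; have /negP := nle n; rewrite -ltNge -muW -UW => /ltW h.
  by rewrite leeBrDr.
rewrite -(fineK (finite_mu mU)) -EFinB lee_fin; lra.
Unshelve. all: by end_near. Qed.

Lemma bigcup_mod0_measure_le (A : (set J)^nat) E (x : \bar R) :
  (forall n, measurable (A n)) ->
  (forall n, subset_mod0 mu (A n) (A n.+1)) -> measurable E ->
  (forall n, mu (E `&` A n) <= x) -> mu (E `&` \bigcup_n A n) <= x.
Proof.
move=> mA iA mE Ax; apply/lee_addgt0Pr => e e0.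
have [n An] := bigcup_mod0_approx mA iA mE e0.
by rewrite (le_trans An)// leeD2r.
Qed.

(** * Essential suprema and maximal members *)

(** The essential supremum of a directed family is approached from within the
    family: join successively members whose measures approach the supremum
    of all measures.  A member [B] sticking out of the union would, joined
    with a late term of the sequence, have measure above that supremum. *)
Lemma directed_mod0_sup G : G !=set0 -> G `<=` measurable ->
  (forall A B, G A -> G B ->
    exists E, [/\ G E, subset_mod0 mu A E & subset_mod0 mu B E]) ->
  exists V : (set J)^nat, [/\ forall n, G (V n),
    forall n, subset_mod0 mu (V n) (V n.+1) &
    forall B, G B -> subset_mod0 mu B (\bigcup_n V n)].
Proof.
move=> [A0 GA0] mG dirG.
pose s := ereal_sup [set mu A | A in G].
have s_ub A : G A -> mu A <= s by move=> GA; apply: ereal_sup_ubound; exists A.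
have sfin : s \is a fin_num.
  rewrite ge0_fin_numE; last exact: le_trans (s_ub _ GA0).
  apply: (@le_lt_trans _ _ (mu setT)); last first.
    by rewrite -ge0_fin_numE //; exact: finite_mu.
  by apply: ge_ereal_sup => _ [A /mG mA <-]; exact: mu_le.
have /choice[A PA] n : exists A, G A /\ s - (n.+1%:R^-1)%:E < mu A.
  have n0 : (0 < n.+1%:R^-1 :> R)%R by rewrite invr_gt0.
  by have [_ [A GA <-] sA] := ub_ereal_sup_adherent n0 sfin; exists A.
have /choice[join Pjoin] (AB : set J * set J) : exists E, G AB.1 -> G AB.2 ->
    [/\ G E, subset_mod0 mu AB.1 E & subset_mod0 mu AB.2 E].
  have [GA|] := pselect (G AB.1); last by exists set0.
  have [GB|] := pselect (G AB.2); last by exists set0.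
  by have [E ?] := dirG _ _ GA GB; exists E.
pose V := fix V n := if n is m.+1 then join (V m, A n) else A 0%N.
have GV n : G (V n).
  elim: n => [|n IH]; first by case: (PA 0%N).
  by case: (Pjoin (V n, A n.+1) IH (PA n.+1).1).
have AV n : subset_mod0 mu (A n) (V n).
  case: n => [|n]; first exact: subset_subset_mod0.
  by case: (Pjoin (V n, A n.+1) (GV n) (PA n.+1).1).
have mV n := mG _ (GV n).
have mU := measurable_bigcup_seq mV.
exists V; split=> // [n|B GB].
  by case: (Pjoin (V n, A n.+1) (GV n) (PA n.+1).1).
have mB := mG _ GB.
apply/eqP; rewrite -measure_le0; apply/lee_addgt0Pr => e.
rewrite add0e => e0.
have [n ne] : exists n, (n.+1%:R^-1 < e)%R.
  by have [n _ /(_ n (leqnn n))] := near_infty_natSinv_lt (PosNum e0); exists n.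
have [E [GE BE VE]] := dirG _ _ GB (GV n).
have mE := mG _ GE.
apply: (@le_trans _ _ (mu (E `\` V n))).
  apply: subset_mod0_measure; try exact: measurableD.
  apply: mu0_sub BE; [by repeat apply: measurableD|exact: measurableD|].
  move=> x [[Bx nUx] nEV]; split=> // Ex; apply: nEV; split=> // Vx.
  by apply: nUx; exists n.
(* [V n] is contained in [E] only modulo a null set. *)
have EVV : mu (V n) <= mu (E `&` V n).
  apply: subset_mod0_measure => //; first exact: measurableI.
  by rewrite /subset_mod0 setDIr setDv setU0.
have := s_ub _ GE; rewrite (mu_splitD mE (mV n)).
have := (PA n).2; have := subset_mod0_measure (mG _ (PA n).1) (mV n) (AV n).
move: EVV.
rewrite -(fineK sfin) -(fineK (finite_mu (mV n))).
rewrite -(fineK (finite_mu (mG _ (PA n).1))).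
rewrite -(fineK (finite_mu (measurableI _ _ mE (mV n)))).
rewrite -(fineK (finite_mu (measurableD mE (mV n)))).
rewrite -EFinB -EFinD lte_fin !lee_fin.
move: ne; set q : R := (_^-1)%R; lra.
Qed.

(** Closure under countable increasing unions suffices for Zorn's lemma, since
    the essential supremum of a chain is such a union. *)
Lemma exists_maximal_in G : G !=set0 -> G `<=` measurable ->
  (forall A : (set J)^nat, (forall n, G (A n)) ->
    (forall n, subset_mod0 mu (A n) (A n.+1)) -> G (\bigcup_n A n)) ->
  exists A, maximal_in mu G A.
Proof.
move=> [A0 GA0] mG GU.
pose T := {A : set J | G A}.
pose le (x y : T) : bool := `[< subset_mod0 mu (sval x) (sval y) >].
have mT (x : T) : measurable (sval x) by exact: (mG _ (svalP x)).
have [||K totK|x xmax] := @ZL_preorder T (exist _ A0 GA0) le.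
- by move=> x; apply/asboolP; exact: subset_subset_mod0.
- move=> x y z /asboolP xy /asboolP yz; apply/asboolP.
  exact: subset_mod0_trans xy yz.
- have [[x0 Kx0]|/set0P/negP/negPn/eqP K0] := pselect (K !=set0); last first.
    by exists (exist _ A0 GA0) => x; rewrite K0.
  have [|_ [x _ <-]|_ _ [x Kx <-] [y Ky <-]|V [KV iV ubV]] :=
      @directed_mod0_sup (sval @` K).
  + by exists (sval x0); exists x0.
  + exact: mT.
  + case: (totK x y Kx Ky) => /asboolP xy.
      by exists (sval y); split; [exists y|exact: xy|exact: subset_subset_mod0].
    by exists (sval x); split; [exists x|exact: subset_subset_mod0|exact: xy].
  + have GV n : G (V n) by have [x _ <-] := KV n; exact: (svalP x).
    exists (exist _ _ (GU V GV iV)) => x Kx; apply/asboolP; apply: ubV.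
    by exists x.
- exists (sval x); split=> [|B GB xB]; first exact: (svalP x).
  by have /asboolP := xmax (exist _ B GB) (introT (asboolP _) xB).
Qed.

(** Of the two parts into which an atomless measure splits a set, the smaller
    one has at most half the measure; iterate. *)
Lemma atomless_small A (e : R) : atomless mu -> measurable A -> 0 < mu A ->
  (0 < e)%R ->
  exists B, [/\ measurable B, B `<=` A, 0 < mu B & mu B <= e%:E].
Proof.
move=> muat mA A0 e0.
have half A' : measurable A' -> 0 < mu A' -> exists B,
    [/\ measurable B, B `<=` A', 0 < mu B & mu B + mu B <= mu A'].
  move=> mA' /(muat _ mA')[B [mB BA B0 BltA]].
  have AB : mu A' = mu (A' `\` B) + mu B.
    by rewrite {1}(mu_splitD mA' mB) (setIidr BA).
  have mAB : measurable (A' `\` B) by exact: measurableD.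
  have [le|/ltW le] := leP (mu B) (mu (A' `\` B)).
    by exists B; split=> //; rewrite AB leeD2r.
  exists (A' `\` B); split=> //; last by rewrite AB leeD2l.
  move: BltA; rewrite AB -[X in X < _]add0e lteD2rE //; exact: finite_mu.
have part n : exists B, [/\ measurable B, B `<=` A, 0 < mu B &
    (fine (mu B) * 2 ^+ n <= fine (mu A))%R].
  elim: n => [|n [B [mB BA B0 le]]]; first by exists A; split; rewrite // mulr1.
  have [B' [mB' BB' B'0]] := half _ mB B0.
  rewrite -(fineK (finite_mu mB)) -(fineK (finite_mu mB')) -EFinD lee_fin.
  move=> le'; exists B'; split=> //; first exact: subset_trans BA.
  rewrite exprS mulrA; apply: le_trans le.
  by rewrite ler_wpM2r ?exprn_ge0 // mulr_natr.
have [n An] : exists n, (fine (mu A) < e * 2 ^+ n)%R.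
  exists (Num.trunc (fine (mu A) / e)).+1.
  rewrite mulrC -ltr_pdivrMr //; apply: (lt_trans (truncnS_gt _)).
  by rewrite -natrX ltr_nat ltn_expl.
have [B [mB BA B0 le]] := part n.
exists B; split=> //; rewrite -(fineK (finite_mu mB)) lee_fin.
by rewrite -(@ler_pM2r _ (2 ^+ n)%R) ?exprn_gt0 // (le_trans le) // ltW.
Qed.

End measure_algebra.

(** * Sets bounded along a family *)

Section chain_bounds.
Context {R : realType} {d : measure_display} {J : measurableType d}.
Variables (mu : {finite_measure set J -> \bar R}) (C : set (set J)).
Variable b : set J -> R.
Hypothesis mC : C `<=` measurable.
Local Notation Fam := (chain_bounded_family mu C b).
Implicit Types (A B X F : set J).

Lemma chain_bounded_sub F1 F2 : measurable F1 -> subset_mod0 mu F1 F2 ->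
  Fam F2 -> Fam F1.
Proof.
move=> mF1 F12 [mF2 F2b]; split=> // A CA; apply: le_trans (F2b _ CA).
have mA := mC CA; rewrite ![_ `&` A]setIC.
by apply: subset_mod0_measure; try exact: measurableI; exact: subset_mod0_setI.
Qed.

Lemma chain_bounded_bigcup (F : (set J)^nat) : (forall n, Fam (F n)) ->
  (forall n, subset_mod0 mu (F n) (F n.+1)) -> Fam (\bigcup_n F n).
Proof.
move=> FF iF; have mF n := (FF n).1.
split=> [|A CA]; first exact: measurable_bigcup_seq.
rewrite setIC; apply: bigcup_mod0_measure_le => // [|n]; first exact: mC.
by rewrite setIC; exact: (FF n).2.
Qed.

Lemma restrict_bounded_maximal X : Fam set0 -> measurable X ->
  exists F, maximal_in mu (restrict_family mu Fam X) F.
Proof.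
move=> F0 mX; apply: exists_maximal_in.
- by exists set0; split=> //; exact: subset_subset_mod0.
- by move=> F [[]].
- move=> F FX iF; split.
    by apply: chain_bounded_bigcup => // n; case: (FX n).
  rewrite /subset_mod0 setD_bigcupl; apply: measure_bigcup_null => n.
    by case: (FX n) => -[? _] _; exact: measurableD.
  by case: (FX n).
Qed.

Lemma bounded_measure_le X F A : measurable X ->
  restrict_family mu Fam X F -> C A -> mu F <= (b A)%:E + mu (X `\` A).
Proof.
move=> mX [[mF Fb] FX] CA; have mA := mC CA.
rewrite (mu_splitD mu mF mA) addeC leeD ?Fb //.
rewrite !setDE ![_ `&` ~` A]setIC.
have mAc : measurable (~` A) by exact: measurableC.
by apply: subset_mod0_measure; try exact: measurableI; exact: subset_mod0_setI.
Qed.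

(** A maximal set almost attains the bound given by a suitable member of the
    chain.  The error is [e] for the slack of that member plus [e] for the
    part of [X \ F] that it misses. *)
Lemma maximal_measure_ge X F (e : R) : atomless mu ->
  (forall A B, C A -> C B -> subset_mod0 mu A B \/ subset_mod0 mu B A) ->
  C set0 -> b set0 = 0%R -> measurable X ->
  maximal_in mu (restrict_family mu Fam X) F -> (0 < e)%R ->
  exists2 A, C A & (b A)%:E + mu (X `\` A) <= mu F + (e + e)%:E.
Proof.
move=> muat totC C0 b0 mX [[[mF Fb] FX] Fmax] e0.
pose T := [set A | C A /\ (b A)%:E <= mu (F `&` A) + e%:E].
have [||A B [CA TA] [CB TB]|V [TV iV ubV]] := @directed_mod0_sup _ _ _ mu T.
- by exists set0; split=> //; rewrite b0 setI0 measure0 add0e lee_fin ltW.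
- by move=> A [/mC].
- case: (totC A B CA CB) => AB.
    by exists B; split=> //; exact: subset_subset_mod0.
  by exists A; split=> //; exact: subset_subset_mod0.
have mV n := mC (TV n).1.
set U := \bigcup_n V n in ubV.
have mU : measurable U by exact: measurable_bigcup_seq.
pose D := X `\` F.
have mD : measurable D by exact: measurableD.
(* Otherwise a small part of [D \ U] could be added to [F]. *)
have DU : mu (D `\` U) = 0.
  apply: contrapT => /eqP; rewrite -measure_gt0 => DU0.
  have [B [mB BDU B0 Be]] := atomless_small muat (measurableD mD mU) DU0 e0.
  have mFB : measurable (F `|` B) by exact: measurableU.
  have FBX : restrict_family mu Fam X (F `|` B).
    split; last first.
      apply: mu0_sub FX; try exact: measurableD.
      by move=> x [[Fx|/BDU[[]]]].
    split=> // A CA; have mA := mC CA.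
    have mFA : measurable (F `&` A) by exact: measurableI.
    have mBA : measurable (B `&` A) by exact: measurableI.
    have leU : mu ((F `|` B) `&` A) <= mu (F `&` A) + mu (B `&` A).
      by rewrite setIUl; exact: measureU2.
    apply: (le_trans leU).
    have [TA|nTA] := pselect (T A).
      rewrite (_ : mu (B `&` A) = 0) ?adde0 ?Fb //.
      apply: mu0_sub (ubV _ TA) => //; first exact: measurableD.
      by move=> x [/BDU[_ nUx]].
    have slack : mu (F `&` A) + e%:E <= (b A)%:E.
      by rewrite leNgt; apply/negP => /ltW ?; apply: nTA.
    apply: le_trans slack; rewrite leeD2l // (le_trans _ Be) //.
    by apply: mu_le.
  have := Fmax _ FBX (subset_subset_mod0 mu (@subsetUl _ F B)).
  rewrite /subset_mod0 setDUl setDv set0U => BF0.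
  suff : mu B = 0 by move=> B00; rewrite B00 ltxx in B0.
  apply: mu0_sub BF0 => //; first exact: measurableD.
  by move=> x Bx; split=> //; have [[]] := BDU _ Bx.
have [n Vn] := bigcup_mod0_approx mV iV mD e0.
exists (V n); first by case: (TV n).
have [CV bV] := TV n.
have mFV : measurable (F `&` V n) by exact: measurableI.
have mFD : measurable (F `\` V n) by exact: measurableD.
have mDV : measurable (D `&` V n) by exact: measurableI.
have mDD : measurable (D `\` V n) by exact: measurableD.
have XV : mu (X `\` V n) <= mu (F `\` V n) + mu (D `\` V n).
  apply: le_trans (measureU2 _ mFD mDD); apply: mu_le; first exact: measurableD.
    exact: measurableU.
  by move=> x [Xx nVx]; have [Fx|Fx] := pselect (F x); [left|right].
have DV : mu (D `\` V n) + mu (D `&` V n) <= mu (D `&` V n) + e%:E.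
  by rewrite -(mu_splitD mu mD (mV n)) (mu_splitD mu mD mU) DU add0e.
rewrite (mu_splitD mu mF (mV n)).
move: bV XV DV.
rewrite -(fineK (finite_mu mu mFV)) -(fineK (finite_mu mu mFD)).
rewrite -(fineK (finite_mu mu mDV)) -(fineK (finite_mu mu mDD)).
rewrite -(fineK (finite_mu mu (measurableD mX (mV n)))).
rewrite -!EFinD !lee_fin; lra.
Qed.

End chain_bounds.

Theorem theorem3p10 (R : realType) (d : measure_display)
    (J : measurableType d) (mu : {finite_measure set J -> \bar R})
    (C : set (set J)) (b : set J -> R)
    (hJ : standard_measure_space mu)
    (hC : closed_chain mu C) (hC0 : C set0)
    (hb : nonneg_function_on mu C b) (hb0 : b set0 = 0%R) :
  measurable_matroid mu (chain_bounded_family mu C b) /\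
  is_rank_function mu (chain_bounded_family mu C b)
    (fun X : set J => ereal_inf [set (b A)%:E + mu (X `\` A) | A in C]).
Proof.
have [[[mC _] totC] _ _] := hC.
have F0 : chain_bounded_family mu C b set0.
  split=> [|A CA]; first exact: measurable0.
  by rewrite set0I measure0 lee_fin; exact: hb.1.
have rank X : measurable X -> forall F,
    maximal_in mu (restrict_family mu (chain_bounded_family mu C b) X) F ->
    ereal_inf [set (b A)%:E + mu (X `\` A) | A in C] = mu F.
  move=> mX F Fmax; apply/eqP; rewrite eq_le; apply/andP; split.
    apply/lee_addgt0Pr => e e0; have e20 : (0 < e / 2)%R by rewrite divr_gt0.
    have [A CA] :=
      maximal_measure_ge mC hJ.2 totC hC0 hb0 mX Fmax e20.
    rewrite -splitr => bA; apply: le_trans bA.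
    by apply: ereal_inf_lbound; exists A.
  apply: le_ereal_inf_tmp => _ [A CA <-].
  exact: (bounded_measure_le mC mX Fmax.1 CA).
split; last first.
  move=> X mX; split; last exact: rank.
  exact: restrict_bounded_maximal.
split=> //.
- split=> [F []//|A B FA mB AB].
  have mA : measurable A by case: FA.
  apply: (chain_bounded_sub mC) FA => //.
  apply: mu0_sub AB; last by move=> x ?; right.
    exact: measurableD.
  by apply: measurableU; exact: measurableD.
- exact: chain_bounded_sub.
- by move=> X mX F1 F2 /(rank _ mX) <- /(rank _ mX).
- exact: chain_bounded_bigcup.
Qed.
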